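(* Let $k$ be a field, $\sigma$ an arbitrary index set, and fix a monomial order on the exponent vectors of $k[x_i]_{i\in\sigma}$. Fix an ideal $I\subseteq k[x_i]_{i\in\sigma}$ and an index set $\iota$, and let $F\subseteq\mathcal{P}(\iota)$ be a filter on the lattice $(\mathcal{P}(\iota),\subseteq)$ such that $\emptyset\notin F$. For every $j\in\iota$ let $\sigma_j\subseteq\sigma$, and let $G_j$ be the reduced Gröbner basis of the ideal $I\cap k[x_i]_{i\in\sigma_j}$ of the subring $k[x_i]_{i\in\sigma_j}\subseteq k[x_i]_{i\in\sigma}$, with respect to the restriction of the given monomial order to exponent vectors supported in $\sigma_j$. If $$\bigcup_{s\in F}\bigcap_{j\in s}\sigma_j=\sigma,$$ then $$\bigcup_{s\in F}\bigcap_{j\in s}G_j$$ is the reduced Gröbner basis of $I$.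
   Context: Let $\mathcal{M} = (\sigma \to_0 \mathbb{N})$ be the set of finitely supported functions $\sigma\to\mathbb{N}$ (exponent vectors); $\sigma$ may be infinite. A monomial order is a binary relation $\le$ on $\mathcal{M}$ such that (1) $\le$ is a well-order (a linear order with no infinite strictly descending chain), (2) $a\le b$ implies $a+c\le b+c$ for all $a,b,c\in\mathcal{M}$, and (3) $0\le a$ for all $a\in\mathcal{M}$. For $\sigma_j\subseteq\sigma$, exponent vectors on $\sigma_j$ are identified with those on $\sigma$ supported in $\sigma_j$ (extension by zero), and the restriction of a monomial order is again a monomial order. For a nonzero polynomial $f=\sum_{j\in\mathcal{M}} a_j x^j$, let $\deg(f)=\max\{j\in\mathcal{M} : a_j\ne 0\}$ (maximum with respect to the monomial order), $\mathrm{LC}(f)=a_{\deg(f)}$, $\mathrm{LM}(f)=x^{\deg(f)}$ and $\mathrm{LT}(f)=\mathrm{LC}(f)\,\mathrm{LM}(f)$. For the zero polynomial, $\mathrm{LM}(0)=0$, $\mathrm{LT}(0)=0$, $\mathrm{LC}(0)=0$. A polynomial is monic if its leading coefficient is $1$. Gröbner basis: a subset $G$ (possibly infinite, possibly empty) of an ideal $I$ is a Gröbner basis of $I$ if $\langle \mathrm{LT}(G)\rangle=\langle \mathrm{LT}(I)\rangle$, where $\mathrm{LT}(G)$, $\mathrm{LT}(I)$ are the sets of leading terms of elements of $G$, $I$, and $\langle\cdot\rangle$ denotes the ideal generated. Reduced Gröbner basis: a subset $G\subseteq I$ is a reduced Gröbner basis of $I$ if (1) $G$ is a Gröbner basis of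 $I$; (2) every $p\in G$ is monic; (3) for all distinct $p,q\in G$, no monomial appearing in $p$ (with nonzero coefficient) is divisible by $\mathrm{LM}(q)$. Every ideal of a polynomial ring over a field (in arbitrarily many variables, with a fixed monomial order) has exactly one reduced Gröbner basis, so one speaks of ''the'' reduced Gröbner basis. *)

(* Defs.v *)
From HB Require Import structures.
From mathcomp Require Import all_boot all_algebra.
From mathcomp Require Import finmap.
From mathcomp Require Import boolp classical_sets filter.
From mathcomp.multinomials Require Import monalg.

Set Implicit Arguments.
Unset Strict Implicit.
Unset Printing Implicit Defensive.

Import GRing.Theory.
Local Open Scope classical_set_scope.
Local Open Scope ring_scope.

(* [{cmonom sigma}] is the monoid of finitely supported functions sigma -> nat;
   it is written multiplicatively: [mmul a b] is the exponent vector a + b and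
   [mone] is the zero vector. *)
Record monomial_order (sigma : choiceType) (le : rel {cmonom sigma}) : Prop :=
  MonomialOrder {
    mo_refl : reflexive le;
    mo_anti : antisymmetric le;
    mo_trans : transitive le;
    mo_total : total le;
    mo_wf : ~ exists u : nat -> {cmonom sigma},
                forall n, le (u n.+1) (u n) /\ u n.+1 <> u n;
    mo_mul : forall a b c, le a b -> le (mmul a c) (mmul b c);
    mo_ge0 : forall a, le mone a
  }.

Section Groebner.
Context (k : fieldType) (sigma : choiceType).

(* k[x_i]_{i in sigma} as the monoid algebra of the exponent vectors *)
Local Notation P := {malg k[{cmonom sigma}]}.

(* Notions about a subring k[x_i]_{i in V} are relative to V, as properties of
   subsets of the ambient ring; V = setT gives the notions for the whole ring. *)
Definition subring_vars (V : set sigma) : set P :=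
  [set f | forall m : {cmonom sigma},
             m \in msupp f -> forall i, m i <> 0%N -> V i].

Definition is_ideal (V : set sigma) (I : set P) : Prop :=
  [/\ I `<=` subring_vars V,
      I 0,
      forall f g, I f -> I g -> I (f + g)
    & forall r f, subring_vars V r -> I f -> I (r * f)].

Definition ideal_gen (V : set sigma) (A : set P) : set P :=
  smallest (is_ideal V) A.

Section Order.
Variable le : rel {cmonom sigma}.

(* Only monomials of f are compared, so for f in [subring_vars V] this is also
   the degree for the restriction of le to exponent vectors supported in V.
   The value at f = 0 is a dummy. *)
Definition deg (f : P) : {cmonom sigma} :=
  xget mone [set m | m \in msupp f /\ forall n, n \in msupp f -> le n m].

Definition LC (f : P) : k := f@_(deg f).

Definition LM (f : P) : P := if f == 0 then 0 else << deg f >>.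

Definition LT (f : P) : P := LC f *: LM f.

Definition monic (f : P) : Prop := LC f = 1.

Definition groebner_basis (V : set sigma) (I G : set P) : Prop :=
  G `<=` I /\ ideal_gen V (LT @` G) = ideal_gen V (LT @` I).

Definition divides_in (V : set sigma) (g f : P) : Prop :=
  exists2 r, subring_vars V r & f = r * g.

Definition reduced_groebner_basis (V : set sigma) (I G : set P) : Prop :=
  [/\ groebner_basis V I G,
      forall p, G p -> monic p
    & forall p q, G p -> G q -> p <> q ->
        forall m, m \in msupp p -> ~ divides_in V (LM q) << m >>].

End Order.
End Groebner.

(* Main.v *)
(* An element g of an ideal I belongs to the reduced Groebner basis of I as soon
   as it is monic, deg g is minimal for divisibility among the leading monomials
   of I, and no other monomial of g is a leading monomial of I; these conditions
   pass to I `&` k[x_i]_{i in V} whenever g only involves variables in V. For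
   each minimal leading monomial, division with remainder provides such a g; it
   involves finitely many variables, so by the covering hypothesis it lies in
   G_j for F-almost all j. Hence the limit set is a Groebner basis. It is reduced
   because any two of its elements lie in a common G_j. *)
Require Import Defs.
From mathcomp Require Import all_boot all_algebra.
From mathcomp Require Import finmap.
From mathcomp Require Import boolp classical_sets filter.
From mathcomp.multinomials Require Import monalg.

Local Open Scope classical_set_scope.

Set Implicit Arguments.
Unset Strict Implicit.
Unset Printing Implicit Defensive.

Import GRing.Theory.
Local Open Scope ring_scope.

(** * Supports and divisibility of exponent vectors *)

Definition supported (sigma : choiceType) (V : set sigma) (m : {cmonom sigma}) :=
  forall i, m i <> 0%N -> V i.

(** No support condition is put on the cofactor, so this relation is the same for every subring [V]
    and carries divisibility from one to another. *)
Definition mdvd (sigma : choiceType) (a b : {cmonom sigma}) :=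
  exists c, b = mmul c a.

Section Monomials.
Context (sigma : choiceType).
Implicit Types (V : set sigma) (a b c : {cmonom sigma}).

Lemma supportedM V a b : supported V (mmul a b) <-> supported V a /\ supported V b.
Proof.
split=> [h|[ha hb] i].
  by split=> i /eqP hi; apply: h; rewrite cmM; apply/eqP; rewrite addn_eq0 negb_and hi ?orbT.
rewrite cmM => /eqP; rewrite addn_eq0 negb_and => /orP[] /eqP; [exact: ha|exact: hb].
Qed.

Lemma mdvd_trans b a c : mdvd a b -> mdvd b c -> mdvd a c.
Proof. by move=> [u ->] [v ->]; exists (mmul v u); rewrite mulmA. Qed.

Lemma mdvd_refl a : mdvd a a.
Proof. by exists mone; rewrite mul1m. Qed.

End Monomials.

(** * Least and greatest elements for a monomial order *)

Section MonomialOrder.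
Context (sigma : choiceType) (le : rel {cmonom sigma}).
Hypothesis hle : monomial_order le.
Implicit Types (a b c m : {cmonom sigma}).

Lemma mo_eq a b : le a b -> le b a -> a = b.
Proof. by move=> ab ba; apply: (mo_anti hle); rewrite ab. Qed.

(** If [S] had no least element, totality would give each member a strictly smaller one; iterating a
    choice of these contradicts [mo_wf]. *)
Lemma mo_min (S : set {cmonom sigma}) a :
  S a -> exists2 m, S m & forall n, S n -> le m n.
Proof.
move=> Sa; apply: contrapT => hmin.
have next (x : {m | S m}) : exists y : {m | S m}, le (sval y) (sval x) /\ sval y <> sval x.
  case: x => m Sm /=; apply: contrapT => hn; apply: hmin; exists m => // n Sn.
  have [//|/negP nmn] := boolP (le m n).
  case: hn; exists (exist _ n Sn) => /=; split.
    by have /orP[] := mo_total hle m n.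
  by move=> e; apply: nmn; rewrite e (mo_refl hle).
have [f hf] := choice next.
by apply: (mo_wf hle); exists (fun n => sval (iter n f (exist _ a Sa))) => n; exact: hf.
Qed.

Lemma mdvd_le a b : mdvd a b -> le a b.
Proof. by move=> [c ->]; have := mo_mul hle a (mo_ge0 hle c); rewrite mul1m. Qed.

Lemma mo_max (s : seq {cmonom sigma}) a :
  a \in s -> exists2 m, m \in s & forall n, n \in s -> le n m.
Proof.
elim: s a => // b s IH a _; case: s IH => [_|c s IH].
  by exists b => [|n]; rewrite inE // => /eqP ->; rewrite (mo_refl hle).
have [m ms hm] := IH c (mem_head _ _).
have /orP[bm|mb] := mo_total hle b m.
  by exists m => [|n]; rewrite inE ?ms ?orbT // => /predU1P[->|/hm].
exists b => [|n]; rewrite ?mem_head // inE => /predU1P[->|/hm nm].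
  by rewrite (mo_refl hle).
exact: (mo_trans hle) nm mb.
Qed.

End MonomialOrder.

(** * Closure properties of subrings and ideals *)

Section Ideals.
Context (k : fieldType) (sigma : choiceType).
Local Notation P := {malg k[{cmonom sigma}]}.
Implicit Types (V : set sigma) (f g : P) (I : set P).

Lemma malgZU1 (c : k) (m : {cmonom sigma}) : c *: << m >> = << c *g m >> :> P.
Proof. by apply/malgP=> n; rewrite [LHS]mcoeffZ [in LHS]mcoeffU mcoeffU mulrnAr mulr1. Qed.

Lemma subring_varsU V (c : k) m : supported V m -> subring_vars V (<< c *g m >> : P).
Proof. by move=> Vm n /(fsubsetP msuppU_le) /fset1P ->. Qed.

Lemma subring_varsD V f g :
  subring_vars V f -> subring_vars V g -> subring_vars V (f + g).
Proof.
move=> Vf Vg m /(fsubsetP (msuppD_le _ _)) /fsetUP[]; first exact: Vf.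
exact: Vg.
Qed.

Lemma subring_varsM V f g :
  subring_vars V f -> subring_vars V g -> subring_vars V (f * g).
Proof.
move=> Vf Vg m /msuppM_le [a [b [ha hb ->]]].
by apply/supportedM; split; [exact: Vf|exact: Vg].
Qed.

Lemma ideal_scale V I (c : k) f : is_ideal V I -> I f -> I (c *: f).
Proof.
case=> _ _ _ hM If; rewrite -mul_malgC; apply: hM => //.
by apply: subring_varsU => i; rewrite cm1.
Qed.

Lemma ideal_sub V I f g : is_ideal V I -> I f -> I g -> I (f - g).
Proof.
move=> hI If Ig; have [_ _ hD _] := hI; apply: hD => //.
by rewrite -scaleN1r; exact: ideal_scale hI Ig.
Qed.

Lemma ideal_subring V I :
  is_ideal setT I -> is_ideal V (I `&` subring_vars V).
Proof.
case=> _ I0 ID IM; split=> [f []//||f g [If Vf] [Ig Vg]|r f Vr [If Vf]].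
- by split=> // m; rewrite msupp0.
- by split; [exact: ID|exact: subring_varsD].
- by split; [exact: IM|exact: subring_varsM].
Qed.

End Ideals.

(** * Leading monomials, division and reduced bases *)

Section Leading.
Context (k : fieldType) (sigma : choiceType) (le : rel {cmonom sigma}).
Hypothesis hle : monomial_order le.
Local Notation P := {malg k[{cmonom sigma}]}.
Implicit Types (V : set sigma) (f g h p q r : P) (I G : set P).
Implicit Types (a b c d m n : {cmonom sigma}).

Lemma degP f : f != 0 ->
  deg le f \in msupp f /\ forall n, n \in msupp f -> le n (deg le f).
Proof.
rewrite -msupp_eq0 => /fset0Pn[a /(mo_max hle) [m mf hm]].
exact: (@xgetI _ mone [set m | m \in msupp f /\ forall n, n \in msupp f -> le n m]
  m (conj mf hm)).
Qed.

Lemma deg_msupp f : f != 0 -> deg le f \in msupp f.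
Proof. by case/degP. Qed.

Lemma le_deg f n : n \in msupp f -> le n (deg le f).
Proof.
by have [->|/degP[_]] := eqVneq f 0; [rewrite msupp0 | apply].
Qed.

Lemma degE f m :
  m \in msupp f -> (forall n, n \in msupp f -> le n m) -> deg le f = m.
Proof.
move=> mf hm; have f0 : f != 0 by apply: contraTneq mf => ->; rewrite msupp0.
by apply: (mo_eq hle); [apply: hm; exact: deg_msupp|exact: le_deg].
Qed.

Lemma monic_neq0 f : Defs.monic le f -> f != 0.
Proof.
move=> fm; apply/eqP=> f0; move: fm.
by rewrite /Defs.monic /LC f0 mcoeff0 => /esym/eqP; rewrite oner_eq0.
Qed.

Lemma LTE f : f != 0 -> LT le f = << LC le f *g deg le f >>.
Proof. by move=> /negPf f0; rewrite /LT /LM f0 malgZU1. Qed.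

Lemma msupp_LT f : f != 0 -> msupp (LT le f) = [fset deg le f]%fset.
Proof.
by move=> f0; rewrite LTE // msuppU mcoeff_eq0 deg_msupp.
Qed.

Lemma LT0 : LT le (0 : P) = 0.
Proof. by rewrite /LT /LM eqxx scaler0. Qed.

(** Zero is excluded because its [deg] is the dummy [mone], which divides every monomial. *)
Definition lead_monoms I : set {cmonom sigma} :=
  [set deg le f | f in I `&` [set f | f != 0]].

Lemma groebner_lead V I G f : groebner_basis le V I G -> I `<=` subring_vars V ->
  I f -> f != 0 -> exists2 g, G g /\ g != 0 & mdvd (deg le g) (deg le f).
Proof.
move=> [GI eqIG] IV If f0.
(* J is the monomial ideal of k[x_i]_{i in V} spanned by the multiples of the
   leading monomials of G. *)
pose J : set P := [set p | subring_vars V p /\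
  forall m, m \in msupp p -> exists2 g, G g /\ g != 0 & mdvd (deg le g) m].
have JI : is_ideal V J.
  split=> [p []//||p q [Vp hp] [Vq hq]|r p Vr [Vp hp]].
  - by split=> m; rewrite msupp0.
  - split; first exact: subring_varsD.
    by move=> m /(fsubsetP (msuppD_le _ _)) /fsetUP[/hp|/hq].
  - split; first exact: subring_varsM.
    move=> m /msuppM_le [a [b [_ /hp [g hg gb] ->]]]; exists g => //.
    by apply: mdvd_trans gb _; exists a.
have GJ : LT le @` G `<=` J.
  move=> _ [g Gg <-]; have [->|g0] := eqVneq g 0.
    by rewrite LT0; case: JI.
  split=> m; rewrite msupp_LT // => /fset1P ->.
    by apply: (IV _ (GI _ Gg)); exact: deg_msupp.
  by exists g => //; exact: mdvd_refl.
have [_] : J (LT le f).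
  apply: (smallest_sub JI GJ); rewrite -/(ideal_gen V _) eqIG.
  by apply: sub_gen_smallest; exists f.
by apply; rewrite msupp_LT //; exact: fset11.
Qed.

(** Converse of [groebner_lead]: each leading term of [I] is a multiple of one from [G]. *)
Lemma groebner_basis_lead V I G : G `<=` I -> I `<=` subring_vars V ->
  (forall f, I f -> f != 0 ->
     exists2 g, G g /\ g != 0 & mdvd (deg le g) (deg le f)) ->
  groebner_basis le V I G.
Proof.
move=> GI IV hG; split=> //; apply/seteqP; split.
  move=> p hp J [hJ IJ]; apply: hp; split=> // _ [g Gg <-]; apply: IJ.
  by exists g => //; exact: GI.
move=> p hp J [hJ GJ]; apply: hp; split=> // _ [f If <-].
have [->|f0] := eqVneq f 0; first by rewrite LT0; case: hJ.
have [g [Gg g0] [c ec]] := hG f If f0.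
have -> : LT le f = << LC le f / LC le g *g c >> * LT le g.
  rewrite !LTE // malgM_def fgmulUU ec divfK //.
  by rewrite mcoeff_neq0 deg_msupp.
case: hJ => _ _ _; apply; last by apply: GJ; exists g.
(* The cofactor stays in the subring because a factor of a monomial supported in [V] is supported in
   [V]. *)
apply: subring_varsU; have : supported V (deg le f).
  by apply: IV (deg_msupp _).
by rewrite ec => /supportedM[].
Qed.

(** Division by all of [I] at once, by well-founded induction on the bound [d], run as a least
    counterexample [e]. *)
Lemma normal_form I d f : is_ideal setT I -> (forall n, n \in msupp f -> le n d) ->
  exists2 r, I (f - r) &
    forall n, n \in msupp r -> le n d /\ ~ lead_monoms I n.
Proof.
move=> hI; pose reducible e := forall f, (forall n, n \in msupp f -> le n e) ->
  exists2 r, I (f - r) & forall n, n \in msupp r -> le n e /\ ~ lead_monoms I n.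
move: f; rewrite -/(reducible d); apply: contrapT => bad_d.
have [e bad_e emin] := mo_min hle (S := [set e | ~ reducible e]) bad_d.
apply: bad_e => f fe.
(* When all monomials of [p] lie strictly below [e], [deg le p] is a smaller bound, hence not a
   counterexample. *)
have below p : (forall n, n \in msupp p -> le n e /\ n <> e) ->
    exists2 r, I (p - r) & forall n, n \in msupp r -> le n e /\ ~ lead_monoms I n.
  move=> hp; have [->|p0] := eqVneq p 0.
    by exists 0 => [|n]; rewrite ?subr0 ?msupp0 //; case: hI.
  have [le_e ne_e] := hp _ (deg_msupp p0).
  apply: contrapT => hn; apply: ne_e; apply: (mo_eq hle) => //.
  apply: (emin) => /(_ p (@le_deg p)) [r Ir hr]; apply: hn; exists r => // n /hr[nd nI].
  by split=> //; exact: (mo_trans hle) nd le_e.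
(* If [e] is a leading monomial of [I], a multiple of [h] cancels the coefficient at [e]; otherwise
   that term moves into the remainder. *)
have [[h [Ih /= h0] hd]|eI] := pselect (lead_monoms I e).
  have he : h@_e != 0 by rewrite mcoeff_neq0 -hd deg_msupp.
  pose c := f@_e / h@_e.
  have [|r Ir hr] := below (f - c *: h); last first.
    exists r => //; rewrite -[f](subrK (c *: h)) addrAC.
    by have [_ _ + _] := hI; apply=> //; exact: ideal_scale hI Ih.
  move=> n hn; split.
    move: hn => /(fsubsetP (msuppB_le _ _)) /fsetUP[/fe//|].
    by move=> /(fsubsetP (msuppZ_le _ _)) /le_deg; rewrite hd.
  by move=> en; move: hn; rewrite -mcoeff_neq0 en mcoeffB mcoeffZ divfK // subrr eqxx.
have [|r Ir hr] := below (f - << f@_e *g e >>).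
  move=> n hn; split.
    move: hn => /(fsubsetP (msuppB_le _ _)) /fsetUP[/fe//|].
    by move=> /(fsubsetP msuppU_le) /fset1P ->; rewrite (mo_refl hle).
  by move=> en; move: hn; rewrite -mcoeff_neq0 en mcoeffB mcoeffUU subrr eqxx.
exists (r + << f@_e *g e >>); first by rewrite opprD addrA addrAC.
move=> n /(fsubsetP (msuppD_le _ _)) /fsetUP[/hr//|].
by move=> /(fsubsetP msuppU_le) /fset1P ->; rewrite (mo_refl hle).
Qed.

(** Scale [f] to be monic, keep its leading monomial and replace the tail by its normal form. *)
Lemma reduced_with_lead I m : is_ideal setT I -> lead_monoms I m ->
  exists g, [/\ I g, Defs.monic le g, deg le g = m
    & forall n, n \in msupp g -> n <> m -> ~ lead_monoms I n].
Proof.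
move=> hI Im; have [f [If /= f0] fm] := Im.
have fmc : f@_m != 0 by rewrite mcoeff_neq0 -fm deg_msupp.
pose t : P := (f@_m)^-1 *: f.
have It : I t by exact: ideal_scale hI If.
have tle n : n \in msupp t -> le n m.
  by move=> /(fsubsetP (msuppZ_le _ _)) /le_deg; rewrite fm.
have [|r Ir hr] := @normal_form I m (t - << m >>) hI.
  move=> n /(fsubsetP (msuppB_le _ _)) /fsetUP[/tle//|].
  by rewrite msuppU1 => /fset1P ->; rewrite (mo_refl hle).
(* The remainder cannot contain [m], which is itself a leading monomial of [I]. *)
have rm : r@_m = 0 by apply: mcoeff_outdom; apply/negP => /hr[].
have gm : (<< m >> + r)@_m = 1 by rewrite mcoeffD mcoeffUU rm addr0.
have dg : deg le (<< m >> + r) = m.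
  apply: degE; first by rewrite -mcoeff_neq0 gm oner_neq0.
  move=> n /(fsubsetP (msuppD_le _ _)); rewrite msuppU1 => /fsetUP[/fset1P->|/hr[]//].
  by rewrite (mo_refl hle).
exists (<< m >> + r); split=> //.
- have -> : << m >> + r = t - (t - << m >> - r) by rewrite -addrA -opprD subKr.
  exact: ideal_sub hI It Ir.
- by rewrite /Defs.monic /LC dg.
- move=> n /(fsubsetP (msuppD_le _ _)); rewrite msuppU1 => /fsetUP[/fset1P->//|/hr[]//].
Qed.

(** The [le]-least leading monomial dividing [m] works, since divisibility implies [le]. *)
Lemma lead_monoms_min I m : lead_monoms I m -> exists2 d, mdvd d m &
  lead_monoms I d /\ forall n, lead_monoms I n -> mdvd n d -> n = d.
Proof.
move=> Im; have [|d [Id dm] dmin] := mo_min hle (S := lead_monoms I `&` [set d | mdvd d m]) (a := m).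
  by split=> //; exact: mdvd_refl.
exists d => //; split=> // n In nd; apply: (mo_eq hle); first exact: mdvd_le.
by apply: dmin; split=> //; exact: mdvd_trans nd dm.
Qed.

Lemma divides_in_LM V q m : q != 0 -> supported V m -> mdvd (deg le q) m ->
  divides_in V (LM le q) << m >>.
Proof.
move=> /negPf q0 Vm [c ec]; exists << c >>.
  by apply: subring_varsU; move: Vm; rewrite ec => /supportedM[].
by rewrite /LM q0 malgM_def fgmulUU mulr1 ec.
Qed.

Lemma mdvd_divides_in V q m : q != 0 ->
  divides_in V (LM le q) << m >> -> mdvd (deg le q) m.
Proof.
move=> /negPf q0 [r _ e].
have : m \in msupp (<< m >> : P) by rewrite msuppU1; exact: fset11.
rewrite e /LM q0 => /msuppM_le [a [b [_ + ->]]].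
by rewrite msuppU1 => /fset1P ->; exists a.
Qed.

(** Minimality yields [g'] in [G] of the same degree as [g]. If they differed, the degree [d] of
    [g - g'] would be a leading monomial of [I] below the cancelled top term, so [d] would occur in
    the tail of [g] or of [g']; both are impossible. *)
Lemma mem_reduced_groebner_basis V I G g : is_ideal V I ->
  reduced_groebner_basis le V I G -> I g -> Defs.monic le g ->
  (forall n, n \in msupp g -> n <> deg le g -> ~ lead_monoms I n) ->
  (forall n, lead_monoms I n -> mdvd n (deg le g) -> n = deg le g) ->
  G g.
Proof.
move=> hI [GB Gmonic Gred] Ig gm gtail gmin; have [GI _] := GB.
have IV : I `<=` subring_vars V by case: hI.
have [g' [Gg' g'0] /gmin dg'] := groebner_lead GB IV Ig (monic_neq0 gm).
have {}dg' : deg le g' = deg le g.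
  by apply: dg'; exists g' => //; split=> //; exact: GI.
have [<-//|] := eqVneq g' g; rewrite eq_sym -subr_eq0 => h0.
have Ih : I (g - g') by apply: ideal_sub hI _ (GI _ Gg').
set d := deg le (g - g').
have dh : d \in msupp (g - g') by exact: deg_msupp.
have dNg : d <> deg le g.
  move=> e; move: dh; rewrite -mcoeff_neq0 e mcoeffB.
  by rewrite -[g@_ _]/(LC le g) -dg' -[g'@_ _]/(LC le g') gm Gmonic // subrr eqxx.
have Id : lead_monoms I d by exists (g - g').
move: dh => /(fsubsetP (msuppB_le _ _)) /fsetUP[dg|dg'_].
  by case: (gtail d).
have [q [Gq q0] qd] := groebner_lead GB IV Ih h0.
(* The divisor [q] of [d] is not [g'], whose degree exceeds [d]; so [q] contradicts reducedness of
   [G] at the monomial [d] of [g']. *)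
have [e|/eqP g'q] := eqVneq g' q.
  case: dNg; apply: (mo_eq hle); first by rewrite -dg'; exact: le_deg.
  by rewrite -dg' e; exact: mdvd_le.
case: (Gred g' q Gg' Gq g'q d dg'_); apply: divides_in_LM => //.
exact: (IV _ (GI _ Gg')).
Qed.

End Leading.

(** * Passage to the limit along the filter *)

Lemma near_subring_vars (k : fieldType) (sigma : choiceType) (iota : Type)
    (F : set (set iota)) (hF : Filter F) (sigma_ : iota -> set sigma)
    (f : {malg k[{cmonom sigma}]}) :
  \bigcup_(s in F) \bigcap_(j in s) sigma_ j = setT ->
  F [set j | subring_vars (sigma_ j) f].
Proof.
move=> hcover.
(* Two finite intersections, over the monomials of [f] and then over the variables of each, reduce
   the claim to a single variable. *)
apply: filterS (filter_bigI (D := msupp f)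
  (f := fun m => [set j | supported (sigma_ j) m]) hF _) => [j hj m mf|m _].
  exact: hj.
apply: filterS (filter_bigI (D := finsupp m)
  (f := fun i => [set j | sigma_ j i]) hF _) => [j hj i /eqP|i _].
  by rewrite cmE_neq0 => im; exact: hj.
have [s Fs hs] : (\bigcup_(s in F) \bigcap_(j in s) sigma_ j) i by rewrite hcover.
by apply: filterS Fs => j sj; exact: hs.
Qed.

Theorem theorem10 (k : fieldType) (sigma : choiceType)
    (le : rel {cmonom sigma}) (hle : monomial_order le)
    (I : set {malg k[{cmonom sigma}]}) (hI : is_ideal setT I)
    (iota : Type) (F : set (set iota)) (hF : ProperFilter F)
    (sigma_ : iota -> set sigma)
    (G_ : iota -> set {malg k[{cmonom sigma}]})
    (hG : forall j : iota,
      reduced_groebner_basis le (sigma_ j)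
        (I `&` subring_vars (sigma_ j)) (G_ j))
    (hcover : \bigcup_(s in F) \bigcap_(j in s) sigma_ j = setT) :
  reduced_groebner_basis le setT I (\bigcup_(s in F) \bigcap_(j in s) G_ j).
Proof.
split.
- apply: (groebner_basis_lead hle) => [g [s Fs Gg]|//|f If f0].
    have [j sj] := filter_ex Fs.
    by have [[GI _] _ _] := hG j; case: (GI _ (Gg j sj)).
  have [|d df [Id dmin]] := lead_monoms_min hle (I := I) (m := deg le f).
    by exists f.
  have [g [Ig gm dg gtail]] := reduced_with_lead hle hI Id.
  exists g; last by rewrite dg.
  split; last exact: monic_neq0 gm.
  exists [set j | subring_vars (sigma_ j) g].
    exact: near_subring_vars.
  move=> j /= gj.
  (* Shrinking the ideal only removes leading monomials, so both conditions on [g] are inherited. *)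
  have sub n : lead_monoms le (I `&` subring_vars (sigma_ j)) n -> lead_monoms le I n.
    by move=> [h [[Ih _] h0] <-]; exists h.
  apply: (mem_reduced_groebner_basis hle (ideal_subring _ hI) (hG j)) => //; rewrite dg.
    by move=> n ng nd /sub; exact: gtail.
  by move=> n /sub; exact: dmin.
- move=> p [s Fs Gp]; have [j sj] := filter_ex Fs.
  by have [_ + _] := hG j; apply; exact: Gp.
- move=> p q [s Fs Gp] [t Ft Gq] pq m mp.
  have [j [sj tj]] := filter_ex (filterI Fs Ft).
  have [[GI _] Gmonic Gred] := hG j.
  have q0 : q != 0 by apply: (@monic_neq0 _ _ le); apply: Gmonic; exact: Gq.
  (* Divisibility in the full ring descends to the subring of [sigma_ j], as [m] is supported
     there. *)
  move=> /(mdvd_divides_in q0) qm.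
  apply: (Gred p q (Gp j sj) (Gq j tj) pq m mp); apply: divides_in_LM => //.
  by have [_] := GI _ (Gp j sj); apply.
Qed.
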